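(* Let $L$ be any normal modal logic satisfying $\Gamma(\mathbf{LP}_2,1,\omega)\subseteq L\subseteq\Gamma(\mathbf{LS},1,2)$. Then $L$ does not have the Lyndon interpolation property.
   Context: Modal formulas use variables, $\bot,\land,\lor,\neg,\to,\Box$. Positive/negative variables: $v^+(p)=\{p\}$, $v^-(p)=\emptyset$, $v^\circ(\bot)=\emptyset$, $\land,\lor,\Box$ preserve polarity, $v^\pm(\neg\varphi)=v^\mp(\varphi)$, $v^+(\varphi\to\psi)=v^-(\varphi)\cup v^+(\psi)$, $v^-(\varphi\to\psi)=v^+(\varphi)\cup v^-(\psi)$. Kripke frames have reflexive transitive relations. $\Gamma(\mathbf{LP}_2,1,\omega)$ is the set of modal formulas true at every world of every Kripke model on every finite frame of the form $W=I\cup F$ with $I,F$ disjoint finite nonempty sets, where $xRy$ holds iff $x\in I$, or $x=y$ (so $I$ is a cluster seeing everything and each element of $F$ is a final point seeing only itself). $\Gamma(\mathbf{LS},1,2)$ is the set of modal formulas true at every world of every Kripke model on the frame $W=\{a,b,c\}$ with $R$ the reflexive transitive closure of $\{(a,b),(b,a),(a,c),(b,c)\}$. A logic $L$ has the Lyndon interpolation property iff whenever $L\vdash\varphi\to\psi$ there is $\rho$ with $v^\circ(\rho)\subseteq v^\circ(\varphi)\cap v^\circ(\psi)$ for $\circ\in\{+,-\}$, $L\vdash\varphi\to\rho$ and $L\vdash\rho\to\psi$. *)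

(* Defs.v *)
From mathcomp Require Import all_boot.

Set Implicit Arguments.
Unset Strict Implicit.
Unset Printing Implicit Defensive.

Inductive form : Type :=
  | Var of nat
  | Bot
  | And of form & form
  | Or of form & form
  | Neg of form
  | Imp of form & form
  | Box of form.

(* [vars true A] is v^+(A) and [vars false A] is v^-(A). *)
Fixpoint vars (s : bool) (A : form) : seq nat :=
  match A with
  | Var p => if s then [:: p] else [::]
  | Bot => [::]
  | And B C => vars s B ++ vars s C
  | Or B C => vars s B ++ vars s C
  | Neg B => vars (~~ s) B
  | Imp B C => vars (~~ s) B ++ vars s C
  | Box B => vars s B
  end.

Fixpoint subst (sigma : nat -> form) (A : form) : form :=
  match A with
  | Var p => sigma p
  | Bot => Bot
  | And B C => And (subst sigma B) (subst sigma C)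
  | Or B C => Or (subst sigma B) (subst sigma C)
  | Neg B => Neg (subst sigma B)
  | Imp B C => Imp (subst sigma B) (subst sigma C)
  | Box B => Box (subst sigma B)
  end.

(* Boolean evaluation in which the formulas [Box B] are treated as atoms. *)
Fixpoint beval (v : nat -> bool) (b : form -> bool) (A : form) : bool :=
  match A with
  | Var p => v p
  | Bot => false
  | And B C => beval v b B && beval v b C
  | Or B C => beval v b B || beval v b C
  | Neg B => ~~ beval v b B
  | Imp B C => beval v b B ==> beval v b C
  | Box B => b B
  end.

Definition tautology (A : form) : Prop := forall v b, beval v b A.

Record normal_modal_logic (L : form -> Prop) : Prop := NormalModalLogic {
  nml_taut : forall A, tautology A -> L A;
  nml_K : forall A B, L (Imp (Box (Imp A B)) (Imp (Box A) (Box B)));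
  nml_mp : forall A B, L (Imp A B) -> L A -> L B;
  nml_nec : forall A, L A -> L (Box A);
  nml_subst : forall sigma A, L A -> L (subst sigma A)
}.

(* Only finite frames occur below, so worlds form a finType and forcing is
   boolean. *)
Record frame : Type := Frame {
  world :> finType;
  acc : rel world;
  acc_refl : reflexive acc;
  acc_trans : transitive acc
}.

Fixpoint forces (W : frame) (V : nat -> pred W) (x : W) (A : form) : bool :=
  match A with
  | Var p => V p x
  | Bot => false
  | And B C => forces V x B && forces V x C
  | Or B C => forces V x B || forces V x C
  | Neg B => ~~ forces V x B
  | Imp B C => forces V x B ==> forces V x C
  | Box B => [forall y, acc x y ==> forces V y B]
  end.

Definition valid (W : frame) (A : form) : Prop :=
  forall (V : nat -> pred W) (x : W), forces V x A.

Definition is_LP2_1_omega_frame (W : frame) : Prop :=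
  exists I F : {set W},
    [/\ I :|: F = [set: W], [disjoint I & F], I != set0, F != set0
      & forall x y : W, acc x y <-> x \in I \/ x = y].

Definition Gamma_LP2_1_omega (A : form) : Prop :=
  forall W : frame, is_LP2_1_omega_frame W -> valid W A.

(* a, b, c are the ordinals 0, 1, 2; [connect] is the reflexive transitive
   closure. *)
Definition LS_1_2_edge : rel 'I_3 :=
  fun x y => (nat_of_ord x, nat_of_ord y) \in [:: (0, 1); (1, 0); (0, 2); (1, 2)].

Definition LS_1_2_frame : frame :=
  Frame (@connect0 _ LS_1_2_edge) (@connect_trans _ LS_1_2_edge).

Definition Gamma_LS_1_2 (A : form) : Prop := valid LS_1_2_frame A.

Definition Lyndon_interpolation (L : form -> Prop) : Prop :=
  forall A B, L (Imp A B) ->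
    exists C, [/\ forall (s : bool) (p : nat),
                    p \in vars s C -> p \in vars s A /\ p \in vars s B,
                  L (Imp A C) & L (Imp C B)].

(* Main.v *)
Require Import Defs.
From mathcomp Require Import all_boot.

(** The implication [ex_diamond -> ex_box] below, i.e.
    <>(p /\ r /\ <>~r) -> ([](p -> []s) -> []s), is valid on the frames I u F:
    the antecedent yields a p-world in the cluster I, which sees all that the
    root sees.  A Lyndon interpolant could only contain p, positively.
    On {a, b, c} such formulas are transferred from b to b between two models,
    the first satisfying the antecedent with p true at a only, the second
    refuting the consequent with p true at c only.  The transfer is along the
    directed bisimulation relating x to y when x = b or y = c. *)

Set Implicit Arguments.
Unset Strict Implicit.
Unset Printing Implicit Defensive.

Section DirectedBisimulation.

Variables (W1 W2 : frame) (V1 : nat -> pred W1) (V2 : nat -> pred W2).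
Variables (Z : W1 -> W2 -> Prop) (P N : nat -> Prop).

Hypothesis atom_pos : forall p x y, P p -> Z x y -> V1 p x -> V2 p y.
Hypothesis atom_neg : forall p x y, N p -> Z x y -> V2 p y -> V1 p x.
Hypothesis zig : forall x y x', Z x y -> acc x x' ->
  exists2 y', acc y y' & Z x' y'.
Hypothesis zag : forall x y y', Z x y -> acc y y' ->
  exists2 x', acc x x' & Z x' y'.

(** [Neg] and [Imp] swap polarities, so both directions go through one induction; at [Box] the
    forward one uses [zag], the backward one [zig]. *)
Lemma directed_bisimulation_forces (C : form) :
  ((forall p, p \in vars true C -> P p) ->
   (forall p, p \in vars false C -> N p) ->
   forall x y, Z x y -> forces V1 x C -> forces V2 y C) /\
  ((forall p, p \in vars true C -> N p) ->
   (forall p, p \in vars false C -> P p) ->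
   forall x y, Z x y -> forces V2 y C -> forces V1 x C).
Proof.
have catP s1 s2 (Q : nat -> Prop) : (forall p, p \in s1 ++ s2 -> Q p) ->
    (forall p, p \in s1 -> Q p) /\ (forall p, p \in s2 -> Q p).
  by move=> H; split=> p hp; apply: H; rewrite mem_cat hp ?orbT.
elim: C => [p||B [IB1 IB2] C [IC1 IC2]|B [IB1 IB2] C [IC1 IC2]|B [IB1 IB2]
           |B [IB1 IB2] C [IC1 IC2]|B [IB1 IB2]] /=.
- by split=> H _ x y zxy; [apply: atom_pos zxy | apply: atom_neg zxy];
    apply: H; rewrite inE.
- by split.
- split=> /catP[HB HC] /catP[KB KC] x y zxy /andP[fB fC]; apply/andP; split.
  + exact: IB1 zxy fB.
  + exact: IC1 zxy fC.
  + exact: IB2 zxy fB.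
  + exact: IC2 zxy fC.
- split=> /catP[HB HC] /catP[KB KC] x y zxy /orP[fB|fC]; apply/orP.
  + by left; apply: IB1 zxy fB.
  + by right; apply: IC1 zxy fC.
  + by left; apply: IB2 zxy fB.
  + by right; apply: IC2 zxy fC.
- split=> H K x y zxy; apply: contra.
  + exact: IB2.
  + exact: IB1.
- split=> /catP[HB HC] /catP[KB KC] x y zxy /implyP f; apply/implyP=> fB.
  + by apply: (IC1 _ _ _ _ zxy) => //; apply: f; apply: IB2 zxy fB.
  + by apply: (IC2 _ _ _ _ zxy) => //; apply: f; apply: IB1 zxy fB.
- split=> H K x y zxy /forallP f; apply/forallP=> w; apply/implyP=> aw.
  + have [w' aw' zw] := zag zxy aw.
    by apply: (IB1 _ _ _ _ zw) => //; apply: (implyP (f w')).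
  + have [w' aw' zw] := zig zxy aw.
    by apply: (IB2 _ _ _ _ zw) => //; apply: (implyP (f w')).
Qed.

End DirectedBisimulation.

Lemma LS_1_2_accE (x y : LS_1_2_frame) :
  acc x y = (x != ord_max) || (x == y).
Proof.
apply/idP/idP.
  by case: (eqVneq x ord_max) => //= -> /connectP[[|z s] //= _ ->].
case: (eqVneq x y) => [-> _|neq_xy]; first exact: acc_refl.
rewrite orbF => x_neq; apply: connect1.
by case: x y neq_xy x_neq => [[|[|[|//]]] hx] [[|[|[|//]]] hy].
Qed.

Definition ex_diamond : form :=
  Neg (Box (Neg (And (Var 0) (And (Var 1) (Neg (Box (Var 1))))))).

Definition ex_box : form :=
  Imp (Box (Imp (Var 0) (Box (Var 2)))) (Box (Var 2)).

Lemma Gamma_LP2_1_omega_ex : Gamma_LP2_1_omega (Imp ex_diamond ex_box).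
Proof.
move=> W [I [F [_ _ _ _ accE]]] V x /=.
apply/implyP=> /forallPn[y]; rewrite negb_imply negbK.
case/andP=> xy /and3P[py ry /forallPn[z]].
rewrite negb_imply => /andP[/accE yz rz].
(* [Var 1] holds at [y] and fails at [z], so [y] sees a world other than itself and is not final. *)
have Iy : y \in I by case: yz rz => // <-; rewrite ry.
apply/implyP=> /forallP box; apply/forallP=> w; apply/implyP=> _.
have /forallP boxy := implyP (implyP (box y) xy) py.
by apply: (implyP (boxy w)); apply/accE; left.
Qed.

Theorem theorem9p2 (L : form -> Prop) :
  normal_modal_logic L ->
  (forall A : form, Gamma_LP2_1_omega A -> L A) ->
  (forall A : form, L A -> Gamma_LS_1_2 A) ->
  ~ Lyndon_interpolation L.
Proof.
move=> _ LP LS lyndon.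
have [C [varsC /LS AC /LS CB]] := lyndon _ _ (LP _ Gamma_LP2_1_omega_ex).
pose a : LS_1_2_frame := @Ordinal 3 0 isT.
pose b : LS_1_2_frame := @Ordinal 3 1 isT.
pose c : LS_1_2_frame := ord_max.
have acc_c x : acc x c by rewrite LS_1_2_accE orNb.
have acc_ab : acc a b by rewrite LS_1_2_accE.
have acc_b x : acc b x by rewrite LS_1_2_accE.
have c_acc x : acc c x -> x = c by rewrite LS_1_2_accE eqxx => /eqP.
pose Z (x y : LS_1_2_frame) := x = b \/ y = c.
pose V1 (p : nat) (x : LS_1_2_frame) := x == a.
pose V2 (p : nat) (x : LS_1_2_frame) := x == c.
have zig x y x' : Z x y -> acc x x' -> exists2 y', acc y y' & Z x' y'.
  by move=> _ _; exists c => //; right.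
have zag x y y' : Z x y -> acc y y' -> exists2 x', acc x x' & Z x' y'.
  case=> -> h; first by exists b => //; left.
  by exists x; [exact: acc_refl | right; apply: c_acc].
(* Variables pass forward because [V1] is false at [b] and [V2] is true at [c]; the choice of
   [False] for [N] allows no negative variable. *)
have atom_pos p x y : True -> Z x y -> V1 p x -> V2 p y.
  by move=> _ [] ->; rewrite /V1 /V2 ?eqxx.
have atom_neg p x y : False -> Z x y -> V2 p y -> V1 p x by [].
have [transfer _] := directed_bisimulation_forces atom_pos atom_neg zig zag C.
have V1b : forces V1 b ex_diamond.
  (* [a] forces [Var 0] and [Var 1] and sees [b], where [Var 1] fails. *)
  apply/forallPn; exists a; rewrite acc_b negbK /=; apply/forallPn; exists b.
  by apply/negP=> /implyP/(_ acc_ab).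
have V2b : ~~ forces V2 b ex_box.
  rewrite /= negb_imply; apply/andP; split.
    (* [Var 0] holds only at [c], which sees only itself and forces [Var 2]. *)
    apply/forallP=> x; apply/implyP=> _; apply/implyP=> /eqP->.
    by apply/forallP=> y; apply/implyP=> /c_acc ->; rewrite /V2.
  by apply/forallPn; exists b; apply/negP=> /implyP/(_ (acc_b b)).
apply: (negP V2b); apply: (implyP (CB V2 b)).
apply: (transfer _ _ b) => //; last 2 first.
- by left.
- exact: (implyP (AC V1 b)).
(* The only negative variable of [ex_diamond] is [Var 1], that of [ex_box] is [Var 2], so [C] has
   none. *)
by move=> p /varsC[]; rewrite !inE => /eqP->.
Qed.
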